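(* Let $\phi_{\mathrm{xor}}$ be a conjunction of xor-constraints and let $k=|\mathrm{vars}(\phi_{\mathrm{xor}})|$. Then $k\text{-Ge}(\phi_{\mathrm{xor}})$ is a GE-simulation formula for $\phi_{\mathrm{xor}}$.
   Context: An xor-constraint is an equation $x_1\oplus\dots\oplus x_n\equiv p$ with Boolean variables and $p\in\{\bot,\top\}$; duplicates cancel; $x\equiv\top$ is identified with the literal $x$, $x\equiv\bot$ with $\neg x$. For a set of variables $Y'=\{y_1,\dots,y_n\}$, $(a\oplus Y'\equiv p)$ means $(a\oplus y_1\oplus\dots\oplus y_n\equiv p)$ and $Y_1\oplus Y_2$ is the symmetric difference. Unit propagation (UP): from $x\equiv\top$ (resp. $x\equiv\bot$) and an xor-constraint $D$ containing $x$ infer $D$ with $x$ replaced by $\top$ (resp. $\bot$); $\psi\vdash_{\mathrm{UP}}E$ means $E$ can be obtained from the constraints of $\psi$ by repeated UP inferences ($E=(\bot\equiv\top)$ being a contradiction). A conjunction $\psi$ of xor-constraints is a GE-simulation formula for $\phi_{\mathrm{xor}}$ if (i) the satisfying truth assignments of $\phi_{\mathrm{xor}}$ are exactly those of $\phi_{\mathrm{xor}}\land\psi$ projected to $\mathrm{vars}(\phi_{\mathrm{xor}})$; (ii) if $\phi_{\mathrm{xor}}$ is satisfiable and $\phi_{\mathrm{xor}}\land l_1\land\dots\land l_r\models\hat l$ for literals $l_1,\dots,l_r,\hat l$, then $\phi_{\mathrm{xor}}\land\psi\land l_1\land\dots\land l_r\vdash_{\mathrm{UP}}\hat l$; (iii)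 if $\phi_{\mathrm{xor}}$ is unsatisfiable then $\phi_{\mathrm{xor}}\land\psi\vdash_{\mathrm{UP}}(\bot\equiv\top)$. The translation $\mathrm{ptable}(Y,\phi,k)$, for a set of variables $Y$, a conjunction $\phi$ and an integer $k$: start with $\phi'=\phi$. (1) For each nonempty $Y'\subseteq Y$ with $|Y'|\le k$: if there is no variable $a$ with $(a\oplus Y'\equiv\bot)$ in $\phi'$, add $(a\oplus Y'\equiv\bot)$ for a new ''alias'' variable $a$ of $Y'$; if $(Y'\equiv p)$ is in $\phi'$ and $(a\equiv p)$ is not, where $a$ is the alias of $Y'$, add $(a\equiv p)$. (2) For each pair of distinct nonempty $Y_1,Y_2\subseteq Y$ with $|Y_1|,|Y_2|\le k$: if some alias $a_3$ with $(a_3\oplus(Y_1\oplus Y_2)\equiv\bot)$ in $\phi'$ exists, let $a_1,a_2$ be the variables with $(a_1\oplus Y_1\equiv\bot)$, $(a_2\oplus Y_2\equiv\bot)$ in $\phi'$, and add $(a_1\oplus a_2\oplus a_3\equiv\bot)$ if not present. Return $\phi'\setminus\phi$. The translation $k\text{-Ge}(\phi_{\mathrm{xor}})$: start with $\phi'=\phi_{\mathrm{xor}}$ and $V=\mathrm{vars}(\phi_{\mathrm{xor}})$; while $V\neq\emptyset$: let $C_x(\phi')$ be the set of constraints of $\phi'$ containing $x$; pick $x\in V$ minimizing $|\mathrm{vars}(C_x(\phi'))\cap V|$; set $\phi'\leftarrow\phi'\land\mathrm{ptable}(\mathrm{vars}(C_x(\phi'))\cap V,\phi',k)$; remove $x$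 from $V$. Return $\phi'\setminus\phi_{\mathrm{xor}}$.
   Formalization: In (ii), when the literals l_1,…,l_r contradict φ_xor, deriving (⊥≡⊤) by UP is accepted instead of l̂, since l̂ itself need not be derivable; and if a set has several aliases, one fixed alias of it is used throughout the run, since varying choices break the claim. *)

(* Defs.v *)
(* MathComp world, with finmap. *)
From mathcomp Require Import all_boot finmap.

Set Implicit Arguments.
Unset Strict Implicit.
Unset Printing Implicit Defensive.

Local Open Scope fset_scope.

Definition symdiff (A B : {fset nat}) : {fset nat} := (A `\` B) `|` (B `\` A).

(* (S, p) stands for the constraint "xor of the variables in S is p"; S is a
   set because duplicated variables cancel. *)
Definition xorc : Type := ({fset nat} * bool)%type.

Definition contradiction : xorc := (fset0, true).

Definition lit : Type := (nat * bool)%type.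
Definition lit_xor (l : lit) : xorc := ([fset l.1], l.2).

Definition cnf : Type := {fset xorc}.

Definition vars (phi : cnf) : {fset nat} := \bigcup_(E <- phi) E.1.

Definition add_lits (phi : cnf) (ls : seq lit) : cnf :=
  phi `|` [fset lit_xor l | l in ls].

Definition assignment : Type := nat -> bool.

Definition sat_xor (tau : assignment) (E : xorc) : Prop :=
  \big[addb/false]_(x <- E.1) tau x = E.2.

Definition sat (tau : assignment) (phi : cnf) : Prop :=
  forall E : xorc, E \in phi -> sat_xor tau E.

Definition satisfiable (phi : cnf) : Prop := exists tau, sat tau phi.

Definition entails (phi : cnf) (E : xorc) : Prop :=
  forall tau, sat tau phi -> sat_xor tau E.

(* Replacing x by the constant b removes x from the left-hand side and adds b
   to the right-hand side. *)
Inductive up (psi : cnf) : xorc -> Prop :=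
| up_in E : E \in psi -> up psi E
| up_prop x b (D : xorc) :
    up psi ([fset x], b) -> up psi D -> x \in D.1 ->
    up psi (D.1 `\ x, b (+) D.2).

(* Assumptions that contradict phi entail every literal, even one whose
   variable occurs nowhere in phi. Unit propagation then derives the
   contradiction, and this is what is required in that case; whenever
   phi and ls are jointly satisfiable, the literal itself has to be derived. *)
Definition GE_simulation (phi psi : cnf) : Prop :=
  [/\ forall tau : assignment,
        sat tau phi <->
        exists2 tau' : assignment,
          {in vars phi, tau =1 tau'} & sat tau' (phi `|` psi),
      satisfiable phi ->
        forall (ls : seq lit) (l : lit),
          entails (add_lits phi ls) (lit_xor l) ->
          up (add_lits (phi `|` psi) ls) (lit_xor l) \/
          (~ satisfiable (add_lits phi ls) /\
           up (add_lits (phi `|` psi) ls) contradiction)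
    & ~ satisfiable phi -> up (phi `|` psi) contradiction].

Definition is_alias (phi : cnf) (a : nat) (S : {fset nat}) : bool :=
  (symdiff [fset a] S, false) \in phi.

(* The translations leave open the order in which subsets, pairs and variables
   are treated and the names of the new variables, so they are given as
   relations between input and possible outcomes. The map alpha fixes "the"
   alias of each set for a whole run: if several variables satisfy is_alias for
   the same set, one and the same of them is used throughout. *)
Definition ptable_alias (alpha : {fset nat} -> nat) (Y Y' : {fset nat})
    (phi phi' : cnf) : Prop :=
  exists phi1 : cnf,
    [/\ (is_alias phi (alpha Y') Y' /\ phi1 = phi) \/
        [/\ forall a, ~~ is_alias phi a Y',
            alpha Y' \notin Y `|` vars phi
          & phi1 = (symdiff [fset alpha Y'] Y', false) |` phi]
      & phi' = phi1 `|`
          [fset (([fset alpha Y'], E.2) : xorc)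
          | E in [fset E in phi1 | E.1 == Y']]].

Definition ptable_pair (alpha : {fset nat} -> nat)
    (Y12 : {fset nat} * {fset nat}) (phi phi' : cnf) : Prop :=
  let: (Y1, Y2) := Y12 in
  let Y3 := symdiff Y1 Y2 in
  ((forall a, ~~ is_alias phi a Y3) /\ phi' = phi) \/
  [/\ is_alias phi (alpha Y1) Y1, is_alias phi (alpha Y2) Y2,
      is_alias phi (alpha Y3) Y3
    & phi' = (symdiff (symdiff [fset alpha Y1] [fset alpha Y2])
                      [fset alpha Y3], false) |` phi].

Fixpoint run (T : Type) (step : T -> cnf -> cnf -> Prop) (ts : seq T)
    (phi phi' : cnf) : Prop :=
  if ts is t :: ts' then
    exists2 phi1, step t phi phi1 & run step ts' phi1 phi'
  else phi' = phi.

Definition subsets_upto (Y : {fset nat}) (k : nat) : seq {fset nat} :=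
  [seq Y' <- fpowerset Y | (Y' != fset0) && (#|` Y'| <= k)].

(* Ordered pairs: ptable_pair adds the same constraint for (Y1, Y2) and for
   (Y2, Y1), so the outcomes are those of treating each unordered pair once. *)
Definition pairs_upto (Y : {fset nat}) (k : nat) :
    seq ({fset nat} * {fset nat}) :=
  [seq Y12 <- [seq (Y1, Y2) | Y1 <- subsets_upto Y k, Y2 <- subsets_upto Y k]
  | Y12.1 != Y12.2].

Definition ptable (alpha : {fset nat} -> nat) (Y : {fset nat}) (phi : cnf)
    (k : nat) (psi : cnf) : Prop :=
  exists ss ps (phi1 phi2 : cnf),
    [/\ perm_eq ss (subsets_upto Y k), perm_eq ps (pairs_upto Y k),
        run (ptable_alias alpha Y) ss phi phi1,
        run (ptable_pair alpha) ps phi1 phi2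
      & psi = phi2 `\` phi].

Definition cls (x : nat) (phi : cnf) : cnf := [fset E in phi | x \in E.1].

Inductive kGe_loop (alpha : {fset nat} -> nat) (k : nat) :
    cnf -> {fset nat} -> cnf -> Prop :=
| kGe_done phi : kGe_loop alpha k phi fset0 phi
| kGe_step phi V x psi phi' :
    x \in V ->
    (forall y, y \in V ->
       #|` vars (cls x phi) `&` V| <= #|` vars (cls y phi) `&` V|) ->
    ptable alpha (vars (cls x phi) `&` V) phi k psi ->
    kGe_loop alpha k (phi `|` psi) (V `\ x) phi' ->
    kGe_loop alpha k phi V phi'.

(* psi is a possible outcome of the translation k-Ge applied to phi. *)
Definition kGe (k : nat) (phi psi : cnf) : Prop :=
  exists (alpha : {fset nat} -> nat) (phi' : cnf),
    kGe_loop alpha k phi (vars phi) phi' /\ psi = phi' `\` phi.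

Section Totality.

Let good (phi : cnf) (D : seq {fset nat}) (alpha : {fset nat} -> nat) : Prop :=
  forall S, S \in D -> is_alias phi (alpha S) S.

(* From any formula and any finite table D of already chosen aliases containing
   those of pre, P has an outcome for all alpha extending some larger finite
   table that contains post. *)
Let total (pre post : seq {fset nat})
    (P : ({fset nat} -> nat) -> cnf -> cnf -> Prop) : Prop :=
  forall phi D alpha, good phi D alpha -> {subset pre <= D} ->
  exists phi' D' alpha',
    [/\ good phi' D' alpha', phi `<=` phi', {subset D ++ post <= D'},
        {in D, alpha' =1 alpha}
      & forall beta, {in D', beta =1 alpha'} -> P beta phi phi'].

Let total_run (T : eqType) (step : ({fset nat} -> nat) -> T -> cnf -> cnf -> Prop)
    (pre : seq {fset nat}) (post : T -> seq {fset nat}) (ts : seq T) :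
  (forall t, t \in ts -> total pre (post t) (fun beta => step beta t)) ->
  total pre (flatten (map post ts)) (fun beta => run (step beta) ts).
Proof.
elim: ts => [|t ts IH] tot phi D alpha gD preD /=.
  by exists phi, D, alpha; split=> // S; rewrite cats0.
have [phi1 [D1 [al1 [g1 s1 d1 e1 p1]]]] :=
  tot t (mem_head _ _) _ _ _ gD preD.
have DD1 : {subset D <= D1} by move=> S SD; apply: d1; rewrite mem_cat SD.
have [||phi2 [D2 [al2 [g2 s2 d2 e2 p2]]]] := IH _ phi1 D1 al1 g1.
- by move=> u uts; apply: tot; rewrite inE uts orbT.
- by move=> S /preD /DD1.
have D12 : {subset D1 <= D2} by move=> S SD; apply: d2; rewrite mem_cat SD.
exists phi2, D2, al2; split=> //.
- exact: fsubset_trans s1 s2.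
- move=> S; rewrite !mem_cat => /or3P[SD|St|Sts].
  + exact/D12/DD1.
  + by apply/D12/d1; rewrite mem_cat St orbT.
  + by apply: d2; rewrite mem_cat Sts orbT.
- by move=> S SD; rewrite e2 ?e1 //; apply: DD1.
move=> beta eb; exists phi1; last exact: p2.
by apply: p1 => S SD; rewrite eb ?e2 //; apply: D12.
Qed.

Let goodS (phi phi' : cnf) D alpha :
  phi `<=` phi' -> good phi D alpha -> good phi' D alpha.
Proof. by move=> /fsubsetP sub g S /g /sub. Qed.

Let good_cons (phi phi' : cnf) D alpha S a :
  phi `<=` phi' -> good phi D alpha -> is_alias phi' a S ->
  (S \in D -> a = alpha S) ->
  let alpha' U := if U == S then a else alpha U in
  good phi' (S :: D) alpha' /\ {in D, alpha' =1 alpha}.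
Proof.
move=> sub g aS eqa alpha'; split=> [U|U UD]; rewrite /alpha'.
  rewrite inE; case: eqP => [->//|_ /=]; exact: goodS sub g U.
by case: eqP => // US; rewrite eqa -US.
Qed.

Let alias_dec (phi : cnf) (S : {fset nat}) :
  (exists a, is_alias phi a S) \/ (forall a, ~~ is_alias phi a S).
Proof.
case: (boolP [exists a : vars phi `|` S, is_alias phi (val a) S]) =>
    [/existsP[a aS]|nex]; first by left; exists (val a).
right=> a; apply/negP=> aS; move/negP: nex; apply.
have aV : a \in vars phi `|` S.
  rewrite inE; case: (boolP (a \in S)) => [_|aNS]; first by rewrite orbT.
  rewrite orbF; apply/bigfcupP; exists (symdiff [fset a] S, false).
    by rewrite andbT.
  by rewrite !inE eqxx aNS.
by apply/existsP; exists [` aV].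
Qed.

Let nil_sub (D : seq {fset nat}) : {subset [::] <= D}.
Proof. by []. Qed.

Let fresh (A : {fset nat}) : exists a, a \notin A.
Proof.
exists (\max_(x <- A) x).+1; apply/negP => aA.
by have := @leq_bigmax_seq _ _ xpredT (fun x : nat => x) _ aA isT; rewrite ltnn.
Qed.

Let total_alias Y Y' : total [::] [:: Y'] (fun beta => ptable_alias beta Y Y').
Proof.
move=> phi D alpha gD _.
have [a [phi1 [sub aS eqa H]]] : exists a phi1,
  [/\ phi `<=` phi1, is_alias phi1 a Y', (Y' \in D -> a = alpha Y')
    & (is_alias phi a Y' /\ phi1 = phi) \/
      [/\ forall b, ~~ is_alias phi b Y', a \notin Y `|` vars phi
        & phi1 = (symdiff [fset a] Y', false) |` phi]].
  case: (boolP (Y' \in D)) => [Y'D|Y'D].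
    by exists (alpha Y'), phi; split=> //; [exact: gD | left; split=> //; exact: gD].
  have [[a aS]|naS] := alias_dec phi Y'.
    by exists a, phi; split=> //; left.
  have [a aN] := fresh (Y `|` vars phi).
  exists a, ((symdiff [fset a] Y', false) |` phi); split=> //.
  - exact: fsubsetU1.
  - exact: fset1U1.
  - by right.
pose phi' := phi1 `|` [fset (([fset a], E.2) : xorc) | E in [fset E in phi1 | E.1 == Y']].
have sub1 : phi1 `<=` phi' by exact: fsubsetUl.
have aS' : is_alias phi' a Y' by move/fsubsetP: sub1; apply.
have [g' e'] := good_cons (fsubset_trans sub sub1) gD aS' eqa.
exists phi', (Y' :: D), (fun U => if U == Y' then a else alpha U); split=> //.
- exact: fsubset_trans sub sub1.
- by move=> S; rewrite mem_cat !inE orbC.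
move=> beta eb; have ba : beta Y' = a by rewrite eb ?mem_head // eqxx.
by exists phi1; rewrite ba; split.
Qed.

Let total_pair Y12 (pre : seq {fset nat}) :
  Y12.1 \in pre -> Y12.2 \in pre ->
  total pre [::] (fun beta => ptable_pair beta Y12).
Proof.
case: Y12 => Y1 Y2 /= Y1p Y2p phi D alpha gD preD.
set Y3 := symdiff Y1 Y2.
have [[a0 a0S]|naS] := alias_dec phi Y3; last first.
  exists phi, D, alpha; split=> //; first by move=> S; rewrite cats0.
  by move=> beta _; left.
have [a aS eqa] : exists2 a, is_alias phi a Y3 & Y3 \in D -> a = alpha Y3.
  case: (boolP (Y3 \in D)) => [Y3D|_]; last by exists a0.
  by exists (alpha Y3) => //; exact: gD.
have [g e] := good_cons (fsubset_refl phi) gD aS eqa.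
set al' := (fun U => _) in g e.
have in1 : Y1 \in Y3 :: D by rewrite inE preD ?orbT.
have in2 : Y2 \in Y3 :: D by rewrite inE preD ?orbT.
have in3 : Y3 \in Y3 :: D by rewrite mem_head.
exists ((symdiff (symdiff [fset al' Y1] [fset al' Y2]) [fset al' Y3], false)
        |` phi), (Y3 :: D), al'; split=> //.
- exact: goodS (fsubsetU1 _ _) g.
- exact: fsubsetU1.
- by move=> S; rewrite cats0 inE => ->; rewrite orbT.
move=> beta eb; right; rewrite !eb //.
by split=> //; exact: g.
Qed.

Let total_ptable Y k : total [::] [::] (fun beta phi phi' =>
  exists2 psi, ptable beta Y phi k psi & phi' = phi `|` psi).
Proof.
move=> phi D alpha gD _.
have [phi1 [D1 [al1 [g1 s1 d1 e1 p1]]]] :=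
  total_run (fun t _ => @total_alias Y t) (ts := subsets_upto Y k) gD
    (@nil_sub _).
have pre1 : {subset subsets_upto Y k <= D1}.
  move=> S SY; apply: d1; rewrite mem_cat; apply/orP; right.
  by apply/flattenP; exists [:: S]; rewrite ?mem_head //; apply/mapP; exists S.
have tp t : t \in pairs_upto Y k ->
    total (subsets_upto Y k) [::] (fun beta => ptable_pair beta t).
  rewrite mem_filter => /andP[_ /allpairsP[[Y1 Y2] [/= Y1s Y2s ->]]].
  exact: total_pair.
have [phi2 [D2 [al2 [g2 s2 d2 e2 p2]]]] := total_run tp g1 pre1.
have DD1 : {subset D <= D1} by move=> S SD; apply: d1; rewrite mem_cat SD.
have D12 : {subset D1 <= D2} by move=> S SD; apply: d2; rewrite mem_cat SD.
exists phi2, D2, al2; split=> //.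
- exact: fsubset_trans s1 s2.
- by move=> S; rewrite cats0 => /DD1 /D12.
- by move=> S SD; rewrite e2 ?e1 //; apply: DD1.
move=> beta eb; exists (phi2 `\` phi).
  exists (subsets_upto Y k), (pairs_upto Y k), phi1, phi2; split=> //.
    by apply: p1 => S SD; rewrite eb ?e2 //; apply: D12.
  exact: p2.
by rewrite fsetUDl fsetDv fsetD0; apply/esym/fsetUidPr; exact: fsubset_trans s1 s2.
Qed.

Let total_loop k V : total [::] [::] (fun beta phi phi' =>
  kGe_loop beta k phi V phi').
Proof.
move En: #|` V| => n; elim: n V En => [|n IH] V En phi D alpha gD _.
  rewrite (cardfs0_eq En); exists phi, D, alpha.
  by split=> // [S|beta _]; [rewrite cats0 | constructor].
have /fset0Pn[x0 x0V] : V != fset0 by rewrite -cardfs_gt0 En.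
pose f (x : V) := #|` vars (cls (val x) phi) `&` V|.
have [x xmin] : exists x : V, forall y, f x <= f y.
  by case: (arg_minnP (P := predT) f (i0 := [` x0V]) isT) => x _ h; exists x => y; exact: h.
have Ex : #|` V `\ val x| = n.
  by have := cardfsD1 (val x) V; rewrite (valP x) En => -[].
have [phi1 [D1 [al1 [g1 s1 d1 e1 p1]]]] :=
  @total_ptable (vars (cls (val x) phi) `&` V) k _ _ _ gD (@nil_sub _).
have [phi2 [D2 [al2 [g2 s2 d2 e2 p2]]]] := IH _ Ex phi1 D1 al1 g1 (@nil_sub _).
rewrite !cats0 in d1 d2.
exists phi2, D2, al2; split=> //.
- exact: fsubset_trans s1 s2.
- by move=> S; rewrite cats0 => /d1 /d2.
- by move=> S SD; rewrite e2 ?e1 //; apply: d1.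
move=> beta eb.
have [|psi pt ephi1] := p1 beta; first by move=> S SD; rewrite eb ?e2 //; apply: d2.
apply: (kGe_step (valP x)) pt _; last by rewrite -ephi1; exact: p2.
by move=> y yV; have := xmin [` yV].
Qed.

(* The relation is never empty: every input has an outcome. *)
Lemma kGe_total (k : nat) (phi : cnf) : exists psi, kGe k phi psi.
Proof.
have g0 : good phi [::] (fun=> 0%N) by [].
have [phi' [D [al [_ _ _ _ p]]]] := @total_loop k (vars phi) _ _ _ g0 (@nil_sub _).
by exists (phi' `\` phi), al, phi'; split=> //; exact: p.
Qed.

End Totality.

(* Main.v *)
(* Variable elimination computes a junction tree whose bag at x is Y, the set of
   remaining neighbours of x, and k is so large that every nonempty subset of a
   bag gets an alias. The parities of subsets of Y that unit propagation knows,
   through their aliases, are then closed under symmetric difference. If no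
   contradiction is derived, a solution can be built greedily, adding variables
   in the reverse of the elimination order: one known parity involving x
   determines x, and the difference of two such parities is known and avoids x.
   The same construction prescribes any parity in a bag whose opposite is not
   known, so a literal that is not propagated is not entailed. *)
Require Import Defs.
From Stdlib Require Import Classical.
From mathcomp Require Import all_boot finmap.

Set Implicit Arguments.
Unset Strict Implicit.
Unset Printing Implicit Defensive.

Local Open Scope fset_scope.

(** * Parities of sets of variables and symmetric difference *)

Definition parity (tau : assignment) (S : {fset nat}) : bool :=
  \big[addb/false]_(x <- S) tau x.

Lemma in_symdiff (A B : {fset nat}) x :
  (x \in symdiff A B) = (x \in A) (+) (x \in B).
Proof. by rewrite !inE; case: (x \in A); case: (x \in B). Qed.

Lemma symdiffC (A B : {fset nat}) : symdiff A B = symdiff B A.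
Proof. by apply/fsetP=> x; rewrite !in_symdiff addbC. Qed.

Lemma symdiffA (A B C : {fset nat}) :
  symdiff A (symdiff B C) = symdiff (symdiff A B) C.
Proof. by apply/fsetP=> x; rewrite !in_symdiff addbA. Qed.

Lemma symdiffv (A : {fset nat}) : symdiff A A = fset0.
Proof. by apply/fsetP=> x; rewrite in_symdiff addbb inE. Qed.

Lemma symdiff0 (A : {fset nat}) : symdiff A fset0 = A.
Proof. by apply/fsetP=> x; rewrite in_symdiff inE addbF. Qed.

Lemma symdiffK (A B : {fset nat}) : symdiff (symdiff A B) B = A.
Proof. by rewrite -symdiffA symdiffv symdiff0. Qed.

Lemma symdiffKl (A B : {fset nat}) : symdiff A (symdiff A B) = B.
Proof. by rewrite symdiffC (symdiffC A) symdiffK. Qed.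

Lemma symdiff_eq0 (A B : {fset nat}) : (symdiff A B == fset0) = (A == B).
Proof.
apply/eqP/eqP=> [AB0|->]; last exact: symdiffv.
by rewrite -(symdiffK A B) AB0 symdiffC symdiff0.
Qed.

Lemma symdiff_sub (A B Y : {fset nat}) :
  A `<=` Y -> B `<=` Y -> symdiff A B `<=` Y.
Proof.
move=> /fsubsetP sA /fsubsetP sB; apply/fsubsetP=> x.
by rewrite !inE => /orP[]/andP[_]; [apply: sA | apply: sB].
Qed.

Lemma symdiff1_in (a : nat) (S : {fset nat}) :
  a \in S -> symdiff [fset a] S = S `\ a.
Proof.
by move=> aS; apply/fsetP=> x; rewrite in_symdiff !inE; case: eqP => [->|]; rewrite ?aS.
Qed.

(** Indicator sums over a common superset [Z] let the parities of different sets be added term by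
    term. *)
Lemma parity_sub tau (S Z : {fset nat}) :
  S `<=` Z -> parity tau S = \big[addb/false]_(x <- Z) ((x \in S) && tau x).
Proof.
move=> sSZ.
transitivity (\big[addb/false]_(x <- S) ((x \in S) && tau x)).
  by apply: eq_big_seq => x ->.
by apply: big_fset_incl => // x _ /negbTE ->.
Qed.

Lemma parity_symdiff tau (A B : {fset nat}) :
  parity tau (symdiff A B) = parity tau A (+) parity tau B.
Proof.
have sAB : symdiff A B `<=` A `|` B.
  by apply: symdiff_sub; [exact: fsubsetUl | exact: fsubsetUr].
rewrite (parity_sub tau sAB) (parity_sub tau (fsubsetUl A B)).
rewrite (parity_sub tau (fsubsetUr A B)) -big_split /=.
by apply: eq_bigr => x _; rewrite in_symdiff andb_addl.
Qed.

Lemma parity1 tau x : parity tau [fset x] = tau x.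
Proof. exact: big_seq_fset1. Qed.

Lemma parity0 tau : parity tau fset0 = false.
Proof. exact: big_seq_fset0. Qed.

Lemma eq_parity (tau tau' : assignment) (S : {fset nat}) :
  {in S, tau =1 tau'} -> parity tau S = parity tau' S.
Proof. by move=> eqt; apply: eq_big_seq. Qed.

Definition upd (tau : assignment) x b : assignment :=
  fun y => if y == x then b else tau y.

Lemma parity_upd tau x b (S : {fset nat}) :
  x \notin S -> parity (upd tau x b) S = parity tau S.
Proof.
move=> xS; apply: eq_parity => y yS; rewrite /upd; case: eqP => // yx.
by rewrite -yx yS in xS.
Qed.

(** Changing the value at [x] flips the parity of [S]; this is how a solution receives the value of
    an eliminated variable. *)
Lemma parity_pivot tau x (S : {fset nat}) p :
  x \in S -> exists b, parity (upd tau x b) S = p.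
Proof.
move=> xS; pose b := p (+) parity tau (S `\ x); exists b.
rewrite -(symdiffK S [fset x]) parity_symdiff parity1 symdiffC symdiff1_in //.
rewrite parity_upd ?inE ?eqxx // /upd eqxx /b.
by rewrite addbC -addbA addbb addbF.
Qed.

(** * Variables and models of a formula *)

Lemma varsP (phi : cnf) x :
  reflect (exists2 E, E \in phi & x \in E.1) (x \in vars phi).
Proof.
apply: (iffP (bigfcupP _ _ _ _)) => [[E]|[E Ephi xE]]; last by exists E; rewrite ?andbT.
by rewrite andbT; exists E.
Qed.

Lemma in_vars (phi : cnf) (E : xorc) : E \in phi -> E.1 `<=` vars phi.
Proof. by move=> Ephi; apply/fsubsetP=> x xE; apply/varsP; exists E. Qed.

Lemma vars_mono (phi phi' : cnf) : phi `<=` phi' -> vars phi `<=` vars phi'.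
Proof.
move=> /fsubsetP sub; apply/fsubsetP=> x /varsP[E Ephi xE].
by apply/varsP; exists E => //; apply: sub.
Qed.

Lemma eq_sat (tau tau' : assignment) (phi : cnf) :
  {in vars phi, tau =1 tau'} -> sat tau phi -> sat tau' phi.
Proof.
move=> eqt stau E Ephi; rewrite /sat_xor -(stau E Ephi); symmetry.
by apply: eq_parity => x xE; apply: eqt; apply: (fsubsetP (in_vars Ephi)).
Qed.

Lemma sat_sub tau (phi phi' : cnf) : phi `<=` phi' -> sat tau phi' -> sat tau phi.
Proof. by move=> /fsubsetP sub stau E /sub /stau. Qed.

Lemma subsets_uptoP (Y S : {fset nat}) k : #|` Y| <= k ->
  (S \in subsets_upto Y k) = (S `<=` Y) && (S != fset0).
Proof.
move=> Yk; rewrite mem_filter fpowersetE andbC.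
case: (boolP (S `<=` Y)) => //= sSY; case: (S != fset0) => //=.
exact: leq_trans (fsubset_leq_card sSY) Yk.
Qed.

(** * Unit propagation on xor-constraints *)

Section UnitPropagation.

Variable F : cnf.

Lemma up_sound (E : xorc) tau : up F E -> sat tau F -> sat_xor tau E.
Proof.
move=> upE stau; elim: upE => [E' /stau //|x b D _ IHx _ IHD xD].
rewrite /sat_xor /= -[LHS]/(parity tau _) -symdiff1_in // parity_symdiff.
by rewrite -[parity _ D.1]/(\big[addb/false]_(y <- D.1) tau y) IHD; congr addb.
Qed.

Lemma up_mono (F' : cnf) (E : xorc) : F `<=` F' -> up F E -> up F' E.
Proof.
move=> /fsubsetP sub; elim=> [E' /sub|x b D _ IHx _ IHD xD]; first exact: up_in.
exact: up_prop.
Qed.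

Hypothesis consistent : ~ up F contradiction.

(** Opposite values for [a] would propagate into each other and leave the contradiction. *)
Lemma up_eq a p q : up F ([fset a], p) -> up F ([fset a], q) -> p = q.
Proof.
move=> upp upq; have := up_prop upp upq (fset11 a).
by rewrite /= fsetDv; case: p q {upp upq} => [] [].
Qed.

Lemma up_edge a b q p : up F (symdiff [fset a] [fset b], q) ->
  up F ([fset a], p) -> a != b -> up F ([fset b], p (+) q).
Proof.
move=> upe upa ab.
have aD : a \in symdiff [fset a] [fset b] by rewrite in_symdiff !inE eqxx (negbTE ab).
have := up_prop upa upe aD; rewrite /= -symdiff1_in //.
by rewrite symdiffKl.
Qed.

Lemma up_equiv a b p : up F (symdiff [fset a] [fset b], false) ->
  up F ([fset a], p) -> up F ([fset b], p).
Proof.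
move=> upe upa; case: (eqVneq a b) => [<-//|ab].
by rewrite -(addbF p); apply: up_edge upe upa ab.
Qed.

(** Two units propagate through the ternary constraint if the variables are distinct. Aliases of
    different sets may coincide, though, and then variables cancel; consistency settles these
    degenerate cases. *)
Lemma up_triangle a b c p q :
  up F (symdiff (symdiff [fset a] [fset b]) [fset c], false) ->
  up F ([fset a], p) -> up F ([fset b], q) -> up F ([fset c], p (+) q).
Proof.
move=> upt upa upb; case: (eqVneq a b) => [ab|ab].
  rewrite ab symdiffv symdiffC symdiff0 in upt.
  by rewrite -ab in upb; rewrite (up_eq upa upb) addbb.
case: (eqVneq a c) => [ac|ac].
  rewrite ac (symdiffC [fset c]) symdiffK in upt.
  by rewrite -ac (up_eq upb upt) addbF.
have aD : a \in symdiff (symdiff [fset a] [fset b]) [fset c].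
  by rewrite !in_symdiff !inE eqxx (negbTE ab) (negbTE ac).
have := up_prop upa upt aD; rewrite /= -symdiff1_in // -symdiffA.
rewrite symdiffKl addbF => upbc.
case: (eqVneq b c) => [bc|bc]; last by rewrite addbC; apply: up_edge upbc upb bc.
rewrite bc symdiffv in upbc.
case: p upa upbc => [_ /consistent //|_ _]; by rewrite -bc.
Qed.

End UnitPropagation.

(** * Conservative extensions *)

(** New variables may be constrained, but no model of [phi] is lost on the old ones. Being reflexive
    and transitive, this passes from single steps to whole runs. *)
Definition extends (phi phi' : cnf) : Prop :=
  phi `<=` phi' /\
  forall tau, sat tau phi ->
    exists2 tau', {in vars phi, tau =1 tau'} & sat tau' phi'.

Lemma extends_refl phi : extends phi phi.
Proof. by split=> // tau stau; exists tau. Qed.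

Lemma extends_trans phi1 phi2 phi3 :
  extends phi1 phi2 -> extends phi2 phi3 -> extends phi1 phi3.
Proof.
move=> [s12 e12] [s23 e23].
split=> [|tau /e12[tau2 eq2 /e23[tau3 eq3 sat3]]].
  exact: fsubset_trans s12 s23.
exists tau3 => // x xphi; rewrite eq2 //; apply: eq3.
exact: (fsubsetP (vars_mono s12)).
Qed.

Lemma extends_entailed (phi phi' : cnf) : phi `<=` phi' ->
  (forall tau, sat tau phi -> sat tau phi') -> extends phi phi'.
Proof. by move=> sub h; split=> // tau /h; exists tau. Qed.

Lemma run_extends (T : eqType) (step : T -> cnf -> cnf -> Prop) ts phi phi' :
  (forall t phi1 phi2, t \in ts -> step t phi1 phi2 -> extends phi1 phi2) ->
  run step ts phi phi' -> extends phi phi'.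
Proof.
elim: ts phi => [|t ts IH] phi ext /=; first by move=> ->; apply: extends_refl.
move=> [phi1 st rn]; apply: extends_trans (ext _ _ _ (mem_head _ _) st) _.
by apply: IH rn => u phi2 phi3 uts; apply: ext; rewrite inE uts orbT.
Qed.

(** The order of a run is arbitrary, so the step treating [t] is located only between two formulas:
    what is present initially is still available to it, and what it adds persists. *)
Lemma run_mem (T : eqType) (step : T -> cnf -> cnf -> Prop) ts phi phi' t :
  (forall t phi1 phi2, t \in ts -> step t phi1 phi2 -> extends phi1 phi2) ->
  run step ts phi phi' -> t \in ts ->
  exists phi1 phi2, [/\ phi `<=` phi1, step t phi1 phi2 & phi2 `<=` phi'].
Proof.
elim: ts phi => [//|u ts IH] phi ext /= [phi1 st rn].
have ext' v phi2 phi3 : v \in ts -> step v phi2 phi3 -> extends phi2 phi3.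
  by move=> vts; apply: ext; rewrite inE vts orbT.
rewrite inE => /orP[/eqP->|tts].
  by exists phi, phi1; split=> //; case: (run_extends ext' rn).
have [phi2 [phi3 [s2 st2 s3]]] := IH _ ext' rn tts.
exists phi2, phi3; split=> //; apply: fsubset_trans s2.
by case: (ext u phi phi1 (mem_head _ _) st).
Qed.

(** * The alias table of a bag *)

Lemma alias_parity (phi : cnf) tau a S :
  is_alias phi a S -> sat tau phi -> tau a = parity tau S.
Proof.
move=> al stau; have := stau _ al; rewrite /sat_xor /= -[LHS]/(parity tau _).
by rewrite parity_symdiff parity1; case: (tau a); case: (parity tau S).
Qed.

Lemma is_alias_sub (phi phi' : cnf) a S :
  phi `<=` phi' -> is_alias phi a S -> is_alias phi' a S.
Proof. by move=> /fsubsetP; apply. Qed.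

Section Table.

Variables (alpha : {fset nat} -> nat) (Y : {fset nat}).

(** A fresh alias takes the parity of its set without disturbing [vars phi], and the units copied to
    an alias follow from its defining constraint. *)
Lemma ptable_alias_extends S phi phi' :
  S `<=` Y -> ptable_alias alpha Y S phi phi' -> extends phi phi'.
Proof.
move=> sSY [phi1 [cases ->]].
have al1 : is_alias phi1 (alpha S) S.
  by case: cases => -[al] => [->//|_ ->]; apply: fset1U1.
apply: (@extends_trans _ phi1).
  case: cases => -[_] => [->|fresh ->]; first exact: extends_refl.
  split=> [|tau stau]; first exact: fsubsetU1.
  have [aY aphi] : alpha S \notin S /\ alpha S \notin vars phi.
    move: fresh; rewrite inE negb_or => /andP[aY ->]; split=> //.
    by apply: contra aY; apply: (fsubsetP sSY).
  have eqt : {in vars phi, tau =1 upd tau (alpha S) (parity tau S)}.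
    by move=> x xphi; rewrite /upd; case: eqP => // xa; rewrite -xa xphi in aphi.
  exists (upd tau (alpha S) (parity tau S)) => // E; rewrite inE => /orP[].
    rewrite inE => /eqP->; rewrite /sat_xor /= -[LHS]/(parity _ _).
    by rewrite parity_symdiff parity1 parity_upd // /upd eqxx addbb.
  exact: (eq_sat eqt).
apply: extends_entailed => [|tau stau E]; first exact: fsubsetUl.
rewrite inE => /orP[/stau //|/imfsetP[D /=]].
rewrite !inE /= => /andP[Dphi /eqP DS] ->; rewrite /sat_xor /= big_seq_fset1.
by rewrite (alias_parity al1 stau) -DS; apply: stau.
Qed.

Lemma ptable_pair_extends S12 phi phi' :
  ptable_pair alpha S12 phi phi' -> extends phi phi'.
Proof.
case: S12 => S1 S2 [[_ ->]|[al1 al2 al3 ->]]; first exact: extends_refl.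
apply: extends_entailed => [|tau stau E]; first exact: fsubsetU1.
rewrite inE => /orP[|/stau //]; rewrite inE => /eqP->.
rewrite /sat_xor /= -[LHS]/(parity _ _) !parity_symdiff !parity1.
rewrite (alias_parity al1 stau) (alias_parity al2 stau) (alias_parity al3 stau).
by rewrite parity_symdiff addbb.
Qed.

Variables (k : nat) (phi psi : cnf).
Hypothesis table : ptable alpha Y phi k psi.

(** Both phases only add constraints, so adding [psi] back to [phi] recovers the formula where the
    runs end. *)
Lemma ptable_runs : exists ss ps (phi1 : cnf),
  [/\ perm_eq ss (subsets_upto Y k) /\ perm_eq ps (pairs_upto Y k),
      run (ptable_alias alpha Y) ss phi phi1,
      run (ptable_pair alpha) ps phi1 (phi `|` psi)
    & forall S phi2 phi3, S \in ss -> ptable_alias alpha Y S phi2 phi3 ->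
        extends phi2 phi3].
Proof.
have [ss [ps [phi1 [phi2 [ess eps run1 run2 ->]]]]] := table.
have ext S phi3 phi4 : S \in ss -> ptable_alias alpha Y S phi3 phi4 -> extends phi3 phi4.
  rewrite (perm_mem ess) mem_filter fpowersetE => /andP[_ sSY].
  exact: ptable_alias_extends.
exists ss, ps, phi1; split=> //; suff sub : phi `<=` phi2.
  by rewrite fsetUDl fsetDv fsetD0; move/fsetUidPr: sub => ->.
have [sub1 _] := run_extends ext run1.
apply: fsubset_trans sub1 _.
by case: (run_extends (fun t _ _ _ => @ptable_pair_extends t _ _) run2).
Qed.

Lemma ptable_extends : extends phi (phi `|` psi).
Proof.
have [ss [ps [phi1 [_ run1 run2 ext]]]] := ptable_runs.
apply: extends_trans (run_extends ext run1) _.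
exact: (run_extends (fun t _ _ _ => @ptable_pair_extends t _ _) run2).
Qed.

Hypothesis Yk : #|` Y| <= k.

Lemma ptable_has_alias (S : {fset nat}) :
  S `<=` Y -> S != fset0 -> is_alias (phi `|` psi) (alpha S) S.
Proof.
move=> sSY S0; have [ss [ps [phi1 [[ess _] run1 run2 ext]]]] := ptable_runs.
have [|phi2 [phi3 [_ [phi4 [cases e3]] s3]]] := run_mem (t := S) ext run1.
  by rewrite (perm_mem ess) subsets_uptoP // sSY.
have [s1 _] := run_extends (fun t _ _ _ => @ptable_pair_extends t _ _) run2.
apply: is_alias_sub (fsubset_trans s3 s1) _; rewrite e3.
apply: is_alias_sub (fsubsetUl _ _) _.
by case: cases => -[al] => [->//|_ ->]; apply: fset1U1.
Qed.

Lemma ptable_unit (S : {fset nat}) p : S `<=` Y -> S != fset0 ->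
  (S, p) \in phi -> ([fset alpha S], p) \in phi `|` psi.
Proof.
move=> sSY S0 Sphi; have [ss [ps [phi1 [[ess _] run1 run2 ext]]]] := ptable_runs.
have [|phi2 [phi3 [s2 [phi4 [cases e3]] s3]]] := run_mem (t := S) ext run1.
  by rewrite (perm_mem ess) subsets_uptoP // sSY.
have [s1 _] := run_extends (fun t _ _ _ => @ptable_pair_extends t _ _) run2.
apply: (fsubsetP (fsubset_trans s3 s1)); rewrite e3 inE; apply/orP; right.
apply/imfsetP; exists (S, p) => //=; rewrite !inE /= eqxx andbT.
have Sphi2 := fsubsetP s2 _ Sphi.
by case: cases => -[_] => [->//|_ ->]; rewrite inE Sphi2 orbT.
Qed.

Lemma ptable_triangle (S1 S2 : {fset nat}) : S1 `<=` Y -> S2 `<=` Y ->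
  S1 != fset0 -> S2 != fset0 -> S1 != S2 ->
  (symdiff (symdiff [fset alpha S1] [fset alpha S2]) [fset alpha (symdiff S1 S2)],
   false) \in phi `|` psi.
Proof.
move=> sS1 sS2 nz1 nz2 S12.
have [ss [ps [phi1 [[ess eps] run1 run2 ext]]]] := ptable_runs.
have [|phi2 [phi3 [s2 st s3]]] := run_mem (t := (S1, S2))
  (fun t _ _ _ => @ptable_pair_extends t _ _) run2.
  rewrite (perm_mem eps) mem_filter S12.
  by apply/allpairsP; exists (S1, S2); rewrite !subsets_uptoP // sS1 sS2 nz1 nz2.
have [|phi4 [phi5 [_ [phi6 [cases e5]] s5]]] :=
  run_mem (t := symdiff S1 S2) ext run1.
  by rewrite (perm_mem ess) subsets_uptoP // symdiff_sub // symdiff_eq0.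
(* All aliases precede all pairs, and [symdiff S1 S2] is itself a nonempty subset of the bag; hence
   the pair step cannot skip. *)
have al3 : is_alias phi2 (alpha (symdiff S1 S2)) (symdiff S1 S2).
  apply: is_alias_sub (fsubset_trans s5 s2) _; rewrite e5.
  apply: is_alias_sub (fsubsetUl _ _) _.
  by case: cases => -[al] => [->//|_ ->]; apply: fset1U1.
apply: (fsubsetP s3); case: st => [[/(_ (alpha (symdiff S1 S2)))]|[_ _ _ ->]].
  by rewrite al3.
exact: fset1U1.
Qed.

End Table.

(** * Building a solution along the elimination order *)

Lemma kGe_loop_extends alpha k phi V phi' :
  kGe_loop alpha k phi V phi' -> extends phi phi'.
Proof.
elim=> [phi1|phi1 V1 x psi phi2 _ _ tab _ IH]; first exact: extends_refl.
exact: extends_trans (ptable_extends tab) IH.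
Qed.

Section Elimination.

Variables (alpha : {fset nat} -> nat) (k : nat) (F : cnf).
Hypothesis consistent : ~ up F contradiction.

(* A variable whose propagated value settles the parity of S. *)
Definition handle (phi : cnf) (S : {fset nat}) (a : nat) : Prop :=
  S = [fset a] \/ a = alpha S /\ is_alias phi a S.

(** Two formulas interact: [phi] is the current stage of the elimination and supplies constraints
    and aliases, while propagation takes place in the final formula [F], which may include
    assumptions. *)
Definition known (phi : cnf) (S : {fset nat}) (p : bool) : Prop :=
  (S, p) \in phi \/ exists2 a, handle phi S a & up F ([fset a], p).

(* The alternative T = fset0 makes plain satisfiability an instance. *)
Definition unrefuted (phi : cnf) (T : {fset nat}) (q : bool) : Prop :=
  T = fset0 /\ q = false \/ exists2 a, handle phi T a & ~ up F ([fset a], ~~ q).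

Definition solves tau (phi : cnf) (V : {fset nat}) : Prop :=
  forall (S : {fset nat}) p, S `<=` V -> known phi S p -> parity tau S = p.

Lemma handle_sub (phi phi' : cnf) S a :
  phi `<=` phi' -> handle phi S a -> handle phi' S a.
Proof. by move=> sub [->|[-> al]]; [left | right; split=> //; apply: is_alias_sub al]. Qed.

Section Step.

Variables (phi psi : cnf) (V : {fset nat}) (x : nat).
Let Y := vars (cls x phi) `&` V.
Hypotheses (xV : x \in V) (xphi : x \in vars phi) (Vk : #|` V| <= k).
Hypotheses (table : ptable alpha Y phi k psi) (subF : phi `|` psi `<=` F).

Let YV : Y `<=` V. Proof. exact: fsubsetIr. Qed.

Let Yk : #|` Y| <= k.
Proof. exact: leq_trans (fsubset_leq_card YV) Vk. Qed.

Let up_table E : E \in phi `|` psi -> up F E.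
Proof. by move=> /(fsubsetP subF)/up_in. Qed.

Lemma in_bag (E : xorc) y : E \in phi -> x \in E.1 -> y \in E.1 -> y \in V -> y \in Y.
Proof.
move=> Ephi xE yE yV; rewrite inE yV andbT.
by apply/varsP; exists E; rewrite // !inE Ephi.
Qed.

Lemma self_bag : [fset x] `<=` Y.
Proof.
rewrite fsub1set; have /varsP[E Ephi xE] := xphi.
exact: (in_bag Ephi xE xE xV).
Qed.

(** Sets avoiding [x] are left to the rest of the elimination; sets containing [x] can be treated
    now only inside the bag. *)
Definition in_scope (S : {fset nat}) : Prop := x \notin S \/ S `<=` Y.

Lemma constraint_in_scope S p : (S, p) \in phi -> S `<=` V -> in_scope S.
Proof.
move=> Sphi sSV; case: (boolP (x \in S)) => xS; [right | by left].
apply/fsubsetP=> y yS; exact: in_bag Sphi xS yS (fsubsetP sSV _ yS).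
Qed.

Lemma single_in_scope a : in_scope [fset a].
Proof.
by case: (eqVneq a x) => [->|ax]; [right; apply: self_bag | left; rewrite inE eq_sym].
Qed.

(* If the alias a of S lies in S, the alias constraint is S `\ a and may avoid x. *)
Lemma handle_cases S a : handle phi S a -> S `<=` V ->
  in_scope S \/
  exists R, [/\ [fset a] `<=` V, R `<=` V, (R, false) \in phi & S = symdiff [fset a] R].
Proof.
move=> [->|[_ al]] sSV; first by left; apply: single_in_scope.
case: (boolP (a \in S)) => aS.
  right; exists (symdiff [fset a] S); rewrite symdiffKl.
  have aV : [fset a] `<=` V by rewrite fsub1set (fsubsetP sSV).
  by split=> //; apply: symdiff_sub.
left; case: (boolP (x \in S)) => xS; [right | by left].
have inS y : y \in S -> y \in symdiff [fset a] S.
  move=> yS; rewrite in_symdiff yS inE; case: eqP => // ya.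
  by rewrite -ya yS in aS.
apply/fsubsetP=> y yS; apply: in_bag al (inS _ xS) (inS _ yS) _.
exact: (fsubsetP sSV).
Qed.

(** A known set outside this scope contains its own alias [a]; it then splits into [[fset a]] and a
    constraint of [phi], both in scope. *)
Lemma solves_in_scope tau :
  (forall (S : {fset nat}) p, S `<=` V -> in_scope S -> known phi S p -> parity tau S = p) ->
  solves tau phi V.
Proof.
move=> h S p sSV kn; case: (kn) => [Sphi|[a ha ua]].
  exact: h (constraint_in_scope Sphi sSV) kn.
case: (handle_cases ha sSV) => [sc|[R [aV RV Rphi ->]]]; first exact: h.
rewrite parity_symdiff (h _ p aV (single_in_scope a)); last first.
  by right; exists a => //; left.
rewrite (h _ _ RV (constraint_in_scope Rphi RV) (or_introl Rphi)).
exact: addbF.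
Qed.

(** The same splitting trades [T] for [[fset a]]: the remaining part is a constraint of [phi] with
    even parity. *)
Lemma unrefuted_in_scope T q : T `<=` V -> unrefuted phi T q ->
  exists T', [/\ T' `<=` V, in_scope T', unrefuted phi T' q
    & forall tau, solves tau phi V -> parity tau T = parity tau T'].
Proof.
move=> TV fr; case: (fr) => [[T0 _]|[a ha na]].
  by exists T; split=> //; left; rewrite T0.
case: (handle_cases ha TV) => [sc|[R [aV RV Rphi ->]]]; first by exists T.
exists [fset a]; split=> //; first exact: single_in_scope.
  by right; exists a => //; left.
move=> tau sol; rewrite parity_symdiff (sol R false RV); last by left.
exact: addbF.
Qed.

(** If [S] is the singleton of [a], its alias constraint is an equivalence between [alpha S] and
    [a], through which values propagate both ways. *)
Lemma handle_up (S : {fset nat}) a p : S `<=` Y -> S != fset0 -> handle phi S a ->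
  up F ([fset alpha S], p) <-> up F ([fset a], p).
Proof.
move=> SY S0 [eS|[-> //]].
have := up_table (ptable_has_alias table Yk SY S0).
by rewrite {2}eS => e; split; apply: up_equiv => //; rewrite symdiffC.
Qed.

Lemma known_up (S : {fset nat}) p : S `<=` Y -> S != fset0 -> known phi S p ->
  up F ([fset alpha S], p).
Proof.
move=> SY S0 [Sphi|[a ha ua]]; last exact/(handle_up _ SY S0 ha).
exact: up_table (ptable_unit table Yk SY S0 Sphi).
Qed.

Lemma bag_symdiff (S1 S2 : {fset nat}) p1 p2 : S1 `<=` Y -> S2 `<=` Y ->
  S1 != fset0 -> S2 != fset0 -> S1 != S2 ->
  up F ([fset alpha S1], p1) -> up F ([fset alpha S2], p2) ->
  up F ([fset alpha (symdiff S1 S2)], p1 (+) p2).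
Proof.
move=> SY1 SY2 nz1 nz2 S12 u1 u2; apply: up_triangle u1 u2 => //.
exact: up_table (ptable_triangle table Yk SY1 SY2 nz1 nz2 S12).
Qed.

Hypothesis IH : forall T q, T `<=` V `\ x -> unrefuted (phi `|` psi) T q ->
  exists2 tau, parity tau T = q & solves tau (phi `|` psi) (V `\ x).

Let IH0 : exists tau, solves tau (phi `|` psi) (V `\ x).
Proof.
have [|tau _ sol] := IH (T := fset0) (q := false) (fsub0set _); first by left.
by exists tau.
Qed.

Let subVx (S : {fset nat}) : S `<=` V -> x \notin S -> S `<=` V `\ x.
Proof. by move=> SV xS; rewrite fsubsetD1 SV. Qed.

Let neq0 (S : {fset nat}) : x \in S -> S != fset0.
Proof. by move=> xS; apply/fset0Pn; exists x. Qed.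

(** The value of [x] stays open in [tau]: any value giving [S0] the parity [p0] is to settle at once
    every known parity through [x] in the bag and the prescribed parity of [T]. *)
Let pivoted T q S0 p0 tau : Prop :=
  solves tau (phi `|` psi) (V `\ x) /\
  forall b, parity (upd tau x b) S0 = p0 ->
    (forall (S : {fset nat}) p, x \in S -> S `<=` Y -> known phi S p -> parity (upd tau x b) S = p) /\
    parity (upd tau x b) T = q.

Lemma unrefuted_sub T q : unrefuted phi T q -> unrefuted (phi `|` psi) T q.
Proof.
move=> [|[a ha na]]; [by left | right; exists a => //].
exact: handle_sub (fsubsetUl _ _) ha.
Qed.

Lemma known_sub S p : known phi S p -> known (phi `|` psi) S p.
Proof.
move=> [Sphi|[a ha ua]]; first by left; rewrite inE Sphi.
by right; exists a => //; apply: handle_sub (fsubsetUl _ _) ha.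
Qed.

(** Adding the known set [S0] to another set through [x] cancels [x], and the triangles of the bag
    make the resulting parity known at the next stage, where the induction hypothesis applies. *)
Lemma pivot_known (T S0 : {fset nat}) q p0 : T `<=` V -> in_scope T -> unrefuted phi T q ->
  x \in S0 -> S0 `<=` Y -> known phi S0 p0 -> exists tau, pivoted T q S0 p0 tau.
Proof.
move=> TV Tsc Tfr xS0 S0Y kn0; have u0 := known_up S0Y (neq0 xS0) kn0.
have xD (S : {fset nat}) : x \in S -> x \notin symdiff S S0 by move=> xS; rewrite in_symdiff xS xS0.
have DV (S : {fset nat}) : S `<=` Y -> symdiff S S0 `<=` V.
  by move=> SY; apply: fsubset_trans YV; apply: symdiff_sub.
have alD (S : {fset nat}) : S `<=` Y -> S != S0 ->
    handle (phi `|` psi) (symdiff S S0) (alpha (symdiff S S0)).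
  move=> SY SS0; right; split=> //.
  by apply: (ptable_has_alias table Yk); rewrite ?symdiff_sub ?symdiff_eq0.
(* The other known parities follow from their differences with [S0]; what remains is to prescribe
   the parity of [T]. *)
suff [tau sol Tq] : exists2 tau, solves tau (phi `|` psi) (V `\ x) &
    forall b, parity (upd tau x b) S0 = p0 -> parity (upd tau x b) T = q.
  exists tau; split=> // b e0; split=> [S p xS SY kn|]; last exact: Tq.
  have u := known_up SY (neq0 xS) kn.
  case: (eqVneq S S0) => [SS0|SS0].
    by rewrite SS0 e0; rewrite SS0 in u; apply: up_eq u0 u.
  rewrite -(symdiffK S S0) parity_symdiff e0 parity_upd ?xD //.
  rewrite (sol (symdiff S S0) (p (+) p0)); first by rewrite -addbA addbb addbF.
    by apply: subVx; [exact: DV | exact: xD].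
  right; exists (alpha (symdiff S S0)); first exact: alD.
  exact: bag_symdiff SY S0Y (neq0 xS) (neq0 xS0) SS0 u u0.
case: (boolP (x \in T)) => xT; last first.
  have [tau Tq sol] := IH (subVx TV xT) (unrefuted_sub Tfr).
  by exists tau => // b _; rewrite parity_upd.
have TY : T `<=` Y by case: Tsc => //; rewrite xT.
have nuT : ~ up F ([fset alpha T], ~~ q).
  case: Tfr => [[T0 _]|[a ha na]]; first by rewrite T0 inE in xT.
  by move=> /(handle_up _ TY (neq0 xT) ha).
(* If [T] is the pivot, its parity is known to be [p0]; since [~~ q] is not propagated for it, [p0]
   must be [q]. *)
case: (eqVneq T S0) => [TS0|TS0].
  have [tau sol] := IH0; exists tau => // b; rewrite TS0 => ->.
  apply/eqP; apply: contraT => pq; case: nuT; rewrite TS0.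
  suff <- : p0 = ~~ q by [].
  by move: pq; case: (p0); case: (q).
(* The prescription on [T] is moved to its difference with [S0], which avoids [x]; refuting it there
   would, by one more triangle with [S0], refute it for [T]. *)
have [|tau Tq sol] := IH (T := symdiff T S0) (q := q (+) p0) (subVx (DV _ TY) (xD _ xT)).
  right; exists (alpha (symdiff T S0)); first exact: alD.
  move=> uD; apply: nuT.
  have DY : symdiff T S0 `<=` Y by apply: symdiff_sub.
  have D0 : symdiff T S0 != fset0 by rewrite symdiff_eq0.
  have DS0 : symdiff T S0 != S0.
    by apply: contraTneq xS0 => <-; apply: xD.
  have := bag_symdiff DY S0Y D0 (neq0 xS0) DS0 uD u0.
  by rewrite symdiffK -addNb -addbA addbb addbF.
exists tau => // b e0; rewrite -(symdiffK T S0) parity_symdiff e0 parity_upd ?xD //.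
by rewrite Tq -addbA addbb addbF.
Qed.

(** If no set through [x] in the bag is known, the value of [x] is free: it is spent on [T] when [T]
    contains [x], and is arbitrary otherwise. *)
Lemma pivot (T : {fset nat}) q : T `<=` V -> in_scope T -> unrefuted phi T q ->
  exists S0 p0 tau, x \in S0 /\ pivoted T q S0 p0 tau.
Proof.
move=> TV Tsc Tfr.
case: (classic (exists S0 p0, [/\ x \in S0, S0 `<=` Y & known phi S0 p0])).
  move=> [S0 [p0 [xS0 S0Y kn]]]; exists S0, p0.
  by have [tau piv] := pivot_known TV Tsc Tfr xS0 S0Y kn; exists tau.
move=> none.
have vac (S : {fset nat}) p : x \in S -> S `<=` Y -> known phi S p -> False.
  by move=> xS SY kn; apply: none; exists S, p.
case: (boolP (x \in T)) => xT.
  have [tau sol] := IH0; exists T, q, tau; split=> //; split=> // b e.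
  by split=> // S p xS SY /(vac _ _ xS SY).
have [tau Tq sol] := IH (subVx TV xT) (unrefuted_sub Tfr).
(* A dummy pivot: with nothing to settle at [x], any value serves. *)
exists [fset x], false, tau; split; first exact: fset11.
split=> // b _; split; last by rewrite parity_upd.
by move=> S p xS SY /(vac _ _ xS SY).
Qed.

Lemma elimination_step T q : T `<=` V -> unrefuted phi T q ->
  exists2 tau, parity tau T = q & solves tau phi V.
Proof.
move=> TV /(unrefuted_in_scope TV)[T' [TV' sc' fr' eqT]].
have [S0 [p0 [tau [xS0 [sol piv]]]]] := pivot TV' sc' fr'.
have [b /piv[solb Tb]] := parity_pivot tau p0 xS0.
suff solV : solves (upd tau x b) phi V.
  by exists (upd tau x b) => //; rewrite eqT.
apply: solves_in_scope => S p SV sc kn.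
case: (boolP (x \in S)) => xS.
  by apply: solb => //; case: sc => //; rewrite xS.
by rewrite parity_upd //; apply: sol (known_sub kn); apply: subVx.
Qed.

End Step.

Lemma elimination phi V phi' : kGe_loop alpha k phi V phi' ->
  phi' `<=` F -> V `<=` vars phi -> #|` V| <= k ->
  forall T q, T `<=` V -> unrefuted phi T q ->
  exists2 tau, parity tau T = q & solves tau phi V.
Proof.
elim=> [phi1|phi1 V1 x psi phi2 xV _ tab loop IH] subF Vphi Vk T q TV fr.
  (* Nothing is left to eliminate, so only the parity of the empty set matters. A unit [([fset a],
     false)] counts as an alias constraint of the empty set and agrees with its parity. *)
  have known0 p : known phi1 fset0 p -> p = false.
    move=> [in0|[a [e0|[_ al]] ua]].
    - by case: p in0 => // /(fsubsetP subF)/up_in.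
    - by move/fsetP/(_ a): e0; rewrite !inE eqxx.
    - have /up_in := fsubsetP subF _ al; rewrite symdiff0 => ua'.
      exact: up_eq ua ua'.
  have T0 : T = fset0 by apply/eqP; rewrite -fsubset0.
  exists (fun=> false); last first.
    by move=> S p; rewrite fsubset0 => /eqP-> /known0 ->; apply: parity0.
  rewrite T0 parity0; case: fr => [[_ ->//]|[a [eT|[_ al]] na]].
    by rewrite eT in T0; move/fsetP/(_ a): T0; rewrite !inE eqxx.
  (* The alias constraint is a unit that makes [a] false, which excludes [q] true. *)
  case: q na => // na; case: na; apply: up_in; apply: (fsubsetP subF).
  by rewrite /is_alias T0 symdiff0 in al.
have sub2 := (kGe_loop_extends loop).1.
apply: (elimination_step xV (fsubsetP Vphi _ xV) Vk tab (fsubset_trans sub2 subF)) => //.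
apply: IH => //.
  apply: fsubset_trans (fsubsetDl _ _) (fsubset_trans Vphi _).
  exact: vars_mono (fsubsetUl _ _).
exact: leq_trans (fsubset_leq_card (fsubsetDl _ _)) Vk.
Qed.

End Elimination.

(** * Assumption literals *)

Lemma add_litsP (phi : cnf) ls E :
  E \in add_lits phi ls <-> E \in phi \/ exists2 m, m \in ls & E = lit_xor m.
Proof.
rewrite inE; split=> [/orP[->|/imfsetP[m /= mls ->]]|[->//|[m mls ->]]].
- by left.
- by right; exists m.
- by apply/orP; right; apply/imfsetP; exists m.
Qed.

Lemma sat_add_lits (phi : cnf) ls tau :
  sat tau (add_lits phi ls) <->
  sat tau phi /\ forall m, m \in ls -> tau m.1 = m.2.
Proof.
split=> [stau|[stau lits] E /add_litsP[/stau //|[m /lits mt ->]]].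
  split=> [E Ephi|m mls]; first by apply/stau/add_litsP; left.
  rewrite -(parity1 tau); apply: (stau (lit_xor m)).
  by apply/add_litsP; right; exists m.
by rewrite /sat_xor /= big_seq_fset1.
Qed.

Lemma add_lits_sub (phi phi' : cnf) ls ls' :
  phi `<=` phi' -> {subset ls <= ls'} -> add_lits phi ls `<=` add_lits phi' ls'.
Proof.
move=> /fsubsetP sub subl; apply/fsubsetP=> E /add_litsP[/sub Ephi|[m /subl mls ->]].
  by apply/add_litsP; left.
by apply/add_litsP; right; exists m.
Qed.

(** * Completeness of unit propagation on the translated formula *)

Section Translation.

Variables (phi phi' : cnf) (alpha : {fset nat} -> nat).
Hypothesis loop : kGe_loop alpha #|` vars phi| phi (vars phi) phi'.

(** When [V] is all of [vars phi], the constraints of [phi] and the literals propagated on its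
    variables are themselves known parities, so one solution meets all of them. *)
Lemma solution_exists F T q : phi' `<=` F -> ~ up F contradiction ->
  T `<=` vars phi -> unrefuted alpha F phi T q ->
  exists tau, [/\ parity tau T = q, sat tau phi
    & forall y c, y \in vars phi -> up F ([fset y], c) -> tau y = c].
Proof.
move=> sub cons TV fr.
have [tau Tq sol] := elimination cons loop sub (fsubset_refl _) (leqnn _) TV fr.
exists tau; split=> // [E Ephi|y c yphi uy].
  by apply: sol (in_vars Ephi) _; left; case: E Ephi.
rewrite -(parity1 tau); apply: sol; first by rewrite fsub1set.
by right; exists y => //; left.
Qed.

Lemma assumptions_complete ls l : entails (add_lits phi ls) (lit_xor l) ->
  up (add_lits phi' ls) (lit_xor l) \/
  (~ satisfiable (add_lits phi ls) /\ up (add_lits phi' ls) contradiction).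
Proof.
move=> ent; have [sub ext] := kGe_loop_extends loop.
(* Assumptions on alias variables are dropped: they could refute phi' without
   refuting phi. *)
pose ls0 := [seq m <- ls | m.1 \in vars phi]; pose F := add_lits phi' ls0.
have subF : F `<=` add_lits phi' ls.
  by apply: add_lits_sub => // m; rewrite mem_filter => /andP[].
(* A model of [phi] and [ls] would extend to [phi'] with the original variables unchanged and thus
   satisfy [F], against soundness of propagation. *)
case: (classic (up F contradiction)) => [upF|cons].
  right; split; last exact: up_mono subF upF.
  move=> [tau /sat_add_lits[/ext[tau' eqt stau'] lits]].
  have : sat tau' F.
    apply/sat_add_lits; split=> // m; rewrite mem_filter => /andP[mphi /lits <-].
    by rewrite eqt.
  by move=> /(up_sound upF); rewrite /sat_xor /= big_seq_fset0.
(* Complementary assumptions, possibly on variables outside [phi], propagate to the contradiction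
   directly. *)
case: (classic (exists y, (y, true) \in ls /\ (y, false) \in ls)) => [[y [yt yf]]|coh].
  right; split=> [[tau /sat_add_lits[_ lits]]|].
    by have := lits _ yt; rewrite (lits _ yf).
  have inF c : (y, c) \in ls -> up (add_lits phi' ls) ([fset y], c).
    by move=> yc; apply: up_in; apply/add_litsP; right; exists (y, c).
  by have := up_prop (inF _ yf) (inF _ yt) (fset11 y); rewrite /= fsetDv.
(* If the literal were not propagated, there would be a model of [phi] and [ls] that violates it. *)
left; apply: NNPP => nup; case: l ent nup => x b ent nup.
have [tau [xt stau lits]] : exists tau, [/\ x \in vars phi -> tau x = ~~ b, sat tau phi
    & forall y c, y \in vars phi -> up F ([fset y], c) -> tau y = c].
  case: (boolP (x \in vars phi)) => xphi.
    have [|||tau [xt stau lits]] := solution_exists (T := [fset x]) (q := ~~ b) _ cons.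
    - exact: fsubsetUl.
    - by rewrite fsub1set.
    - right; exists x; first by left.
      by rewrite negbK => /(up_mono subF).
    by exists tau; split=> // _; rewrite -(parity1 tau).
  have [|||tau [_ stau lits]] := solution_exists (T := fset0) (q := false) _ cons.
  - exact: fsubsetUl.
  - exact: fsub0set.
  - by left.
  by exists tau.
(* Outside [vars phi] the coherent assumptions decide and [~~ b] is the default, so that [x]
   violates the literal unless [(x, b)] is itself assumed. *)
pose tau' y := if y \in vars phi then tau y else if (y, b) \in ls then b else ~~ b.
have stau' : sat tau' (add_lits phi ls).
  apply/sat_add_lits; split.
    by apply: (eq_sat _ stau) => y yphi; rewrite /tau' yphi.
  move=> [y c] yc /=; rewrite /tau'; case: ifP => yphi.
    apply: lits => //; apply: up_in; apply/add_litsP; right.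
    by exists (y, c) => //; rewrite mem_filter yphi.
  case: ifP => yb; last by case: (c) (b) yc yb => [] [] // ->.
  case: (c =P b) => // cb; case: coh; exists y.
  by case: (c) (b) cb yc yb => [] [].
have := ent _ stau'; rewrite /sat_xor /= big_seq_fset1 /tau'.
case: ifP => [/xt ->|_]; first by case: (b).
case: ifP => [xb|_]; last by case: (b).
by case: nup; apply: up_in; apply/add_litsP; right; exists (x, b).
Qed.

End Translation.

Theorem theorem4 (phi : cnf) (psi : cnf) :
  kGe #|` vars phi| phi psi -> GE_simulation phi psi.
Proof.
move=> [alpha [phi' [loop ->]]]; have [sub ext] := kGe_loop_extends loop.
rewrite /GE_simulation fsetUDl fsetDv fsetD0 (fsetUidPr _ _ sub).
split=> [tau|_ ls l|unsat].
- split=> [/ext //|[tau' eqt /(sat_sub sub)]].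
  by apply: eq_sat => x xphi; rewrite eqt.
- exact: assumptions_complete loop _ _.
(* With the empty set prescribed and no assumptions, a consistent [phi'] yields a model of [phi]. *)
- apply: NNPP => cons; case: unsat.
  have [||tau [_ stau _]] := solution_exists loop (T := fset0) (q := false)
    (fsubset_refl _) cons.
  + exact: fsub0set.
  + by left.
  by exists tau.
Qed.
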